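(* For fixed $k\in\{1,\dots,n-1\}$, the number of distributive (equivalently, modular) intervals $[\sigma_k,w]_{\mathrm{wk}}$ (with $w\in\mathfrak{S}_n$, $\sigma_k\le_{\mathrm{wk}}w$) in the weak order on $\mathfrak{S}_n$ is $C_n-C_{n-1}$, where $C_i$ is the $i$th Catalan number.
   Context: $\mathfrak{S}_n$ is the symmetric group with Coxeter generators $\sigma_1,\dots,\sigma_{n-1}$, where $\sigma_i$ is the transposition swapping $i$ and $i+1$. A reduced decomposition of $w$ is a word of minimal length in these generators with product $w$. (Right) weak order: $v\le_{\mathrm{wk}}w$ if some reduced decomposition of $v$ is a prefix of a reduced decomposition of $w$. $[v,w]_{\mathrm{wk}}=\{u: v\le_{\mathrm{wk}}u\le_{\mathrm{wk}}w\}$ for $v\le_{\mathrm{wk}}w$. An interval is called distributive (modular) if it is a distributive (modular) lattice. Catalan numbers: $C_i=\frac{1}{i+1}\binom{2i}{i}$. *)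

(* Defs.v *)
From HB Require Import structures.
From mathcomp Require Import all_boot all_order all_fingroup.
From mathcomp Require Import boolp.

Set Implicit Arguments.
Unset Strict Implicit.
Unset Printing Implicit Defensive.

Local Open Scope group_scope.

Lemma ltn_predS n (i : 'I_n.-1) : (i.+1 < n)%N.
Proof. by case: n i => [|n] [i]. Qed.

(* Points and generators are numbered from 0: [sigma i] swaps the points i and
   i+1 of {0, .., n-1}, so it is the generator usually written sigma_(i+1). *)
Definition sigma n (i : 'I_n.-1) : 'S_n :=
  tperm (Ordinal (ltnW (ltn_predS i))) (Ordinal (ltn_predS i)).

(* The product in 'S_n composes from left to right; composing from right to
   left instead replaces every permutation by its inverse and fixes each
   [sigma i], so the weak order below is the same up to this relabelling. *)
Definition word_prod n (s : seq 'I_n.-1) : 'S_n := \prod_(i <- s) sigma i.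

Definition reduced_decomposition n (w : 'S_n) (s : seq 'I_n.-1) : Prop :=
  word_prod s = w /\ forall t, word_prod t = w -> (size s <= size t)%N.

Definition weak_le n (v w : 'S_n) : Prop :=
  exists s t, [/\ reduced_decomposition v s, reduced_decomposition w t
                & prefix s t].

Definition weak_interval n (v w u : 'S_n) : Prop := weak_le v u /\ weak_le u w.

(* [f] is an isomorphism from the ordered type L onto the interval [v, w] with
   the weak order; injectivity of [f] follows from antisymmetry in L. *)
Definition weak_interval_iso n (v w : 'S_n) d (L : porderType d)
    (f : L -> 'S_n) : Prop :=
  (forall u, weak_interval v w u <-> exists x, f x = u) /\
  (forall x y, (x <= y)%O <-> weak_le (f x) (f y)).

Definition distributive_interval n (v w : 'S_n) : Prop :=
  exists (d : Order.disp_t) (L : distrLatticeType d) (f : L -> 'S_n),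
    weak_interval_iso v w f.

Definition modular_law d (L : latticeType d) : Prop :=
  forall x y z : L, (x <= z -> x `|` (y `&` z) = (x `|` y) `&` z)%O.

Definition modular_interval n (v w : 'S_n) : Prop :=
  exists (d : Order.disp_t) (L : latticeType d) (f : L -> 'S_n),
    modular_law L /\ weak_interval_iso v w f.

Definition catalan (i : nat) : nat := 'C(2 * i, i) %/ i.+1.

(* Main.v *)
(* A permutation is determined by its set of inverted pairs of positions, and
   the weak order is inclusion of these sets. Left multiplication by sigma_k
   identifies [sigma_k, w] with [1, v], where v = sigma_k w has an ascent at k.
   If v avoids 321, the inversion sets below v are closed under union and
   intersection, so [1, v] is distributive. Otherwise a minimal u <= v
   containing 321 has the pattern on three consecutive values, and undoing it
   yields a hexagon below u, which violates the modular law.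
   It remains to count the 321-avoiding permutations with an ascent at k.
   Inserting the maximal value into a 321-avoiding permutation is allowed
   exactly where an increasing suffix starts; refining by the position from
   which the permutation increases gives the ballot recursion, hence C_n in
   total, and C_(n-1) for those with a descent at k. *)
Require Import Defs.
From HB Require Import structures.
From mathcomp Require Import all_boot all_order all_fingroup.
From mathcomp Require Import boolp.
From mathcomp Require Import zify.

Set Implicit Arguments.
Unset Strict Implicit.
Unset Printing Implicit Defensive.

(** * Inversion sets and the weak order *)

Section Inversions.
Local Open Scope nat_scope.

Definition inversions n (u : 'S_n) : {set 'I_n * 'I_n} :=
  [set p : 'I_n * 'I_n | (p.1 < p.2) && (u p.2 < u p.1)].

Definition ninv n (u : 'S_n) := #|inversions u|.

Definition lo n (i : 'I_n.-1) : 'I_n := Ordinal (ltnW (ltn_predS i)).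
Definition hi n (i : 'I_n.-1) : 'I_n := Ordinal (ltn_predS i).

Lemma in_inversions n (u : 'S_n) x y :
  ((x, y) \in inversions u) = (x < y) && (u y < u x).
Proof. by rewrite inE. Qed.

Lemma perm_neq_val n (u : 'S_n) (x y : 'I_n) : x < y -> (u x : nat) <> u y.
Proof.
by move=> lxy /val_inj /perm_inj exy; move: lxy; rewrite exy ltnn.
Qed.

Lemma sigma_lo n (i : 'I_n.-1) : sigma i (lo i) = hi i.
Proof. exact: tpermL. Qed.

Lemma sigma_hi n (i : 'I_n.-1) : sigma i (hi i) = lo i.
Proof. exact: tpermR. Qed.

Lemma sigmaK n (i : 'I_n.-1) : (sigma i * sigma i = 1)%g.
Proof. exact: tperm2. Qed.

Lemma sigmaKx n (i : 'I_n.-1) x : sigma i (sigma i x) = x.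
Proof. by rewrite -permM sigmaK perm1. Qed.

Lemma val_sigma n (i : 'I_n.-1) (c : 'I_n) :
  (sigma i c : nat) = if c == i :> nat then i.+1 else
                      if c == i.+1 :> nat then i : nat else c.
Proof.
case: (eqVneq (c : nat) i) => [eci|nci].
  by rewrite (_ : c = lo i) ?sigma_lo //; apply: val_inj.
case: (eqVneq (c : nat) i.+1) => [eci|nci'].
  by rewrite (_ : c = hi i) ?sigma_hi //; apply: val_inj.
rewrite /sigma tpermD //; first by apply: contra nci => /eqP <-.
by apply: contra nci' => /eqP <-.
Qed.

Lemma ltn_sigma n (i : 'I_n.-1) (c d : 'I_n) :
  (c, d) != (lo i, hi i) -> (c, d) != (hi i, lo i) ->
  (sigma i c < sigma i d) = (c < d).
Proof.
rewrite !val_sigma !xpair_eqE -!val_eqE /=.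
case: c d => c /= _ [d /= _]; case: (eqVneq c i) => ?; case: (eqVneq d i) => ?;
  case: (eqVneq c i.+1) => ?; case: (eqVneq d i.+1) => ?; rewrite /=; lia.
Qed.

(** The product swaps the values [i] and [i+1]; comparisons with a third value do not change, so
    only the pair of positions holding these two is affected. *)
Lemma inversions_mulr_asc n (u : 'S_n) (i : 'I_n.-1) :
  (u^-1)%g (lo i) < (u^-1)%g (hi i) ->
  inversions (u * sigma i)%g
    = ((u^-1)%g (lo i), (u^-1)%g (hi i)) |: inversions u.
Proof.
move=> asc; apply/setP => -[p q]; rewrite in_setU1 !in_inversions !permM.
have [/eqP|ne] := eqVneq (p, q) ((u^-1)%g (lo i), (u^-1)%g (hi i)).
  rewrite xpair_eqE => /andP[/eqP-> /eqP->].
  by rewrite asc !permKV sigma_lo sigma_hi /= ltnSn.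
have [lpq|] := boolP (p < q) => //=.
rewrite ltn_sigma //.
  apply/negP; rewrite xpair_eqE => /andP[/eqP eq /eqP ep]; move: lpq asc.
  by rewrite -eq -ep !permK; lia.
apply: contraNN ne; rewrite !xpair_eqE => /andP[/eqP<- /eqP<-].
by rewrite !permK !eqxx.
Qed.

Lemma inversions_mulr_desc n (u : 'S_n) (i : 'I_n.-1) :
  (u^-1)%g (hi i) < (u^-1)%g (lo i) ->
  inversions (u * sigma i)%g
    = inversions u :\ ((u^-1)%g (hi i), (u^-1)%g (lo i)).
Proof.
move=> desc.
have := @inversions_mulr_asc n (u * sigma i)%g i.
rewrite invMg !permM /sigma tpermV -/(sigma i) sigma_lo sigma_hi => /(_ desc).
rewrite -mulgA sigmaK mulg1 => ->.
rewrite setU1K // in_inversions !permM !permKV sigma_lo sigma_hi desc /=.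
by rewrite -leqNgt.
Qed.

Lemma card_inversions_mulr n (u : 'S_n) (i : 'I_n.-1) :
  ninv (u * sigma i)%g <= (ninv u).+1 /\
  (ninv (u * sigma i)%g = (ninv u).+1 ->
     inversions u \subset inversions (u * sigma i)%g).
Proof.
case: (ltngtP ((u^-1)%g (lo i)) ((u^-1)%g (hi i))) => cmp.
- rewrite /ninv inversions_mulr_asc //; split; last by rewrite subsetUr.
  by rewrite cardsU1; case: (_ \in _) => /=; lia.
- rewrite /ninv inversions_mulr_desc //.
  rewrite [#|inversions u|](cardsD1 ((u^-1)%g (hi i), (u^-1)%g (lo i))).
  set c := #|_ :\ _|; set b := nat_of_bool _.
  by split=> [|e]; [lia | exfalso; move: e; lia].
- by move/val_inj/perm_inj/(congr1 val): cmp => /=; lia.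
Qed.

Lemma word_prod_rcons n (s : seq 'I_n.-1) i :
  (word_prod (rcons s i) = word_prod s * sigma i)%g.
Proof. by rewrite /word_prod big_rcons. Qed.

Lemma word_prod_cat n (s t : seq 'I_n.-1) :
  (word_prod (s ++ t) = word_prod s * word_prod t)%g.
Proof. by rewrite /word_prod big_cat. Qed.

Lemma card_inversions_mul_word n (u : 'S_n) (s : seq 'I_n.-1) :
  ninv (u * word_prod s)%g <= ninv u + size s.
Proof.
elim/last_ind: s => [|s i IHs]; first by rewrite /word_prod big_nil mulg1 addn0.
rewrite word_prod_rcons mulgA size_rcons.
have [le _] := card_inversions_mulr (u * word_prod s)%g i.
by apply: leq_trans le _; rewrite addnS ltnS.
Qed.

(** Each letter adds at most one inversion, so if the count grows by the full length, no letter
    removes any. *)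
Lemma inversions_sub_mul_word n (u : 'S_n) (s : seq 'I_n.-1) :
  ninv (u * word_prod s)%g = ninv u + size s ->
  inversions u \subset inversions (u * word_prod s)%g.
Proof.
elim/last_ind: s => [|s i IHs]; first by rewrite /word_prod big_nil mulg1.
rewrite word_prod_rcons mulgA size_rcons => eqc.
have [le sub] := card_inversions_mulr (u * word_prod s)%g i.
have e : ninv (u * word_prod s)%g = ninv u + size s.
  by apply/eqP; rewrite eqn_leq card_inversions_mul_word -ltnS -addnS -eqc le.
by apply: subset_trans (IHs e) (sub _); rewrite eqc e addnS.
Qed.

Lemma perm_asc_id n (u : 'S_n) :
  (forall i : 'I_n.-1, u (lo i) < u (hi i)) -> u = 1%g.
Proof.
move=> asc.
(* Values rise by at least [m] over [m] steps; comparing with the first and the last point pins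
   [u x] to [x]. *)
have le m : forall x y : 'I_n, (y = x + m :> nat) -> u x + m <= u y.
  elim: m => [|m IHm] x y.
    by rewrite addn0 => /val_inj ->; rewrite addn0.
  move=> eyx.
  have lt_i : y.-1 < n.-1 by case: y eyx => y /= ltyn; lia.
  have := asc (Ordinal lt_i); set j := Ordinal lt_i.
  have -> : hi j = y by apply: val_inj => /=; lia.
  have := IHm x (lo j) _; rewrite /= => /(_ _); move: eyx => /=.
  by move=> eyx /(_ ltac:(lia)); lia.
apply/permP => x; rewrite perm1; apply: val_inj.
have n0 : 0 < n by case: x => x /=; lia.
have lastP : n.-1 < n by lia.
have := le x (Ordinal n0) x erefl.
have := le (n.-1 - x) x (Ordinal lastP) _.
move=> /(_ ltac:(case: (x) => /=; lia)).
by case: (u (Ordinal lastP)) (u x) (x) => [a ?] [b ?] [c ?] /=; lia.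
Qed.

(** Unless [v = w], the quotient [v^-1 * w] has a descent at some [i]. The values [i] and [i+1] of
    [v] then stand in increasing order, as otherwise their positions would be an inversion of [v]
    but not of [w]. Appending [sigma i] adds an inversion of [w], and the gap shrinks. *)
Lemma inversions_word n (v w : 'S_n) : inversions v \subset inversions w ->
  exists2 t, (w = v * word_prod t)%g &
             ninv w = ninv v + size t.
Proof.
have [m] := ubnP (ninv w - ninv v).
elim: m => // m IHm in v *; move=> lt_m sub.
have [asc|] := boolP [forall i, (v^-1 * w)%g (lo i) < (v^-1 * w)%g (hi i)].
  have := perm_asc_id (fun i => forallP asc i).
  move/(canRL (mulKVg v)); rewrite mulg1 => ->.
  by exists [::]; rewrite ?addn0 // /word_prod big_nil mulg1.
rewrite negb_forall => /existsP[i]; rewrite !permM => nasc.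
case: (ltngtP ((v^-1)%g (lo i)) ((v^-1)%g (hi i))) => cmp; last first.
- by move/val_inj/perm_inj/(congr1 val): cmp => /=; lia.
- have : ((v^-1)%g (hi i), (v^-1)%g (lo i)) \in inversions v.
    by rewrite in_inversions cmp !permKV /= ltnSn.
  by move/(subsetP sub); rewrite in_inversions (negPf nasc) andbF.
have := inversions_mulr_asc cmp; set p := (_, _) => invE.
have pw : p \in inversions w.
  by rewrite in_inversions cmp /=; have := perm_neq_val (u := w) cmp; lia.
have nvp : p \notin inversions v by rewrite in_inversions !permKV /=; lia.
have subi : inversions (v * sigma i)%g \subset inversions w.
  by rewrite invE subUset sub1set pw.
have ci : ninv (v * sigma i)%g = (ninv v).+1.
  by rewrite /ninv invE cardsU1 nvp.
have lec : ninv (v * sigma i)%g <= ninv w := subset_leq_card subi.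
case: (IHm (v * sigma i)%g) => [|//|t wE cE]; first by lia.
exists (i :: t); last by rewrite cE ci /=; lia.
by rewrite wE /word_prod big_cons mulgA.
Qed.

Lemma inversions1 n : inversions (1 : 'S_n)%g = set0.
Proof. by apply/setP => -[x y]; rewrite in_inversions !perm1 inE; lia. Qed.

Lemma ninv1 n : ninv (1 : 'S_n)%g = 0.
Proof. by rewrite /ninv inversions1 cards0. Qed.

Lemma size_reduced n (w : 'S_n) s :
  reduced_decomposition w s <-> word_prod s = w /\ size s = ninv w.
Proof.
have lower t : ninv (word_prod t : 'S_n) <= size t.
  by have := card_inversions_mul_word 1%g t; rewrite mul1g ninv1.
have [|t wE cE] := @inversions_word n 1%g w; first by rewrite inversions1 sub0set.
rewrite mul1g ninv1 add0n in wE cE.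
split=> [[sE min]|[sE sz]]; split=> //.
  by apply/eqP; rewrite eqn_leq cE min // -cE -sE lower.
by move=> t' t'E; rewrite sz -t'E.
Qed.

(** Lengths add up along a reduced word, so the inversions of a prefix persist. Conversely, a
    reduced word of [v] extends by the word that [inversions_word] gives from [v] to [w]. *)
Lemma weak_leP n (v w : 'S_n) :
  weak_le v w <-> inversions v \subset inversions w.
Proof.
split=> [[s [t [/size_reduced[<- ss] /size_reduced[<- st] /prefixP[r tE]]]]|sub].
  move: st; rewrite tE word_prod_cat size_cat ss => st.
  by apply: inversions_sub_mul_word; rewrite st.
have [|s vE sE] := @inversions_word n 1%g v; first by rewrite inversions1 sub0set.
rewrite mul1g ninv1 add0n in vE sE.
have [t wE tE] := inversions_word sub.
exists s, (s ++ t); split; last exact: prefix_prefix.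
  by apply/size_reduced.
by apply/size_reduced; rewrite word_prod_cat -vE -wE size_cat tE sE.
Qed.

Lemma inversions_inj n : injective (@inversions n).
Proof.
move=> v w e.
have [|t vE] := @inversions_word n w v; first by rewrite e.
rewrite /ninv e => /eqP; rewrite -[X in X == _]addn0 eqn_add2l eq_sym size_eq0.
by move=> /eqP tE; rewrite vE tE /word_prod big_nil mulg1.
Qed.

End Inversions.

(** * Left multiplication by a generator *)

Section LeftMultiplication.
Local Open Scope nat_scope.

(** Swapping the positions [k] and [k+1] relabels the inversions and, given the ascent, creates one
    at these positions. *)
Lemma inversions_mull n (k : 'I_n.-1) (u : 'S_n) x y :
  u (lo k) < u (hi k) ->
  ((x, y) \in inversions (sigma k * u)%g)
    = ((x, y) == (lo k, hi k)) ||
      (x < y) && ((sigma k x, sigma k y) \in inversions u).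
Proof.
move=> asc; rewrite !in_inversions !permM.
have [/eqP|ne] := eqVneq (x, y) (lo k, hi k).
  by rewrite xpair_eqE => /andP[/eqP-> /eqP->];
    rewrite sigma_lo sigma_hi asc /= ltnSn.
have [lxy|] := boolP (x < y) => //=.
rewrite ltn_sigma ?lxy //; apply/negP; rewrite xpair_eqE => /andP[/eqP ex /eqP ey].
by move: lxy; rewrite ex ey /= ltnNge leqnSn.
Qed.

(** Both sides undergo the same relabelling, and the new pair lies in both products but is an
    inversion of neither [u] nor [v]. *)
Lemma sub_inversions_mull n (k : 'I_n.-1) (u v : 'S_n) :
  u (lo k) < u (hi k) -> v (lo k) < v (hi k) ->
  (inversions (sigma k * u)%g \subset inversions (sigma k * v)%g)
    = (inversions u \subset inversions v).
Proof.
move=> ascu ascv; apply/idP/idP => /subsetP sub; apply/subsetP => -[x y] xyP.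
  have [lxy lu] : x < y /\ u y < u x by apply/andP; rewrite -in_inversions.
  have nxy : (x, y) != (lo k, hi k).
    apply: contraTN lu; rewrite xpair_eqE => /andP[/eqP-> /eqP->].
    by rewrite -leqNgt ltnW.
  have nyx : (x, y) != (hi k, lo k).
    apply: contraTN lxy; rewrite xpair_eqE => /andP[/eqP-> /eqP->].
    by rewrite /= -leqNgt leqnSn.
  have lsxy : sigma k x < sigma k y by rewrite ltn_sigma.
  have := sub (sigma k x, sigma k y).
  rewrite !inversions_mull // !sigmaKx xyP lsxy orbT => /(_ isT) /orP[|//].
  rewrite xpair_eqE => /andP[/eqP ex /eqP ey]; case/negP: nyx.
  by rewrite -(sigmaKx k x) -(sigmaKx k y) ex ey sigma_lo sigma_hi eqxx.
move: xyP; rewrite !inversions_mull // => /orP[->//|/andP[-> xyP]].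
by rewrite sub ?orbT.
Qed.

Lemma sigma_weak_le n (k : 'I_n.-1) (w : 'S_n) :
  weak_le (sigma k) w <-> w (hi k) < w (lo k).
Proof.
rewrite weak_leP -(mul1g (sigma k)) inversions_mulr_asc ?invg1 ?perm1 //=.
by rewrite inversions1 setU0 sub1set in_inversions /= ltnSn.
Qed.

Lemma weak_interval_sigma n (k : 'I_n.-1) (v u : 'S_n) :
  v (lo k) < v (hi k) ->
  weak_interval (sigma k) (sigma k * v)%g u
    <-> inversions (sigma k * u)%g \subset inversions v.
Proof.
move=> ascv; split=> [[/sigma_weak_le uk /weak_leP]|sub].
  rewrite -[X in inversions X](mulKg (sigma k)) /sigma tpermV -/(sigma k).
  by rewrite sub_inversions_mull // !permM sigma_lo sigma_hi.
(* Whatever lies below [v] inherits its ascent at [k]. *)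
have ascu : (sigma k * u)%g (lo k) < (sigma k * u)%g (hi k).
  have := @perm_neq_val n (sigma k * u)%g (lo k) (hi k) (ltnSn k).
  move=> ne; rewrite ltn_neqAle; apply/andP; split; first exact/eqP.
  rewrite leqNgt; apply/negP => desc.
  have /(subsetP sub) : (lo k, hi k) \in inversions (sigma k * u)%g.
    by rewrite in_inversions desc /= ltnSn.
  by rewrite in_inversions [v _ < _]ltnNge (ltnW ascv) andbF.
split; first by apply/sigma_weak_le; move: ascu; rewrite !permM sigma_lo sigma_hi.
apply/weak_leP; rewrite -[u](mulKg (sigma k)) /sigma tpermV -/(sigma k).
by rewrite sub_inversions_mull.
Qed.

Lemma weak_interval_iso_sigma n (k : 'I_n.-1) (v : 'S_n) d (L : porderType d)
    (f : L -> 'S_n) :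
  v (lo k) < v (hi k) ->
  weak_interval_iso (sigma k) (sigma k * v)%g f <->
  (forall u, inversions u \subset inversions v <->
             exists x, (sigma k * f x)%g = u) /\
  (forall x y, (x <= y)%O <-> inversions (sigma k * f x)%g \subset
                              inversions (sigma k * f y)%g).
Proof.
move=> ascv.
have sK u : (sigma k * (sigma k * u))%g = u.
  by rewrite mulgA sigmaK mul1g.
have asc u : inversions u \subset inversions v -> u (lo k) < u (hi k).
  rewrite -[u in inversions u]sK => /(weak_interval_sigma _ ascv)[/sigma_weak_le + _].
  by rewrite !permM sigma_lo sigma_hi.
have surjE : (forall u, weak_interval (sigma k) (sigma k * v)%g u <->
      exists x, f x = u) <->
    (forall u, inversions u \subset inversions v <->
             exists x, (sigma k * f x)%g = u).
  split=> H u.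
    have := H (sigma k * u)%g; rewrite weak_interval_sigma // sK => ->.
    by split=> -[x xE]; exists x; [rewrite xE sK | rewrite -xE sK].
  rewrite weak_interval_sigma // H.
  by split=> -[x xE]; exists x; [rewrite -[u]sK -xE sK | rewrite xE].
have le x y : (forall u, inversions u \subset inversions v <->
             exists x, (sigma k * f x)%g = u) ->
    weak_le (f x) (f y) <-> inversions (sigma k * f x)%g \subset
                              inversions (sigma k * f y)%g.
  move=> surj; rewrite weak_leP -{1}(sK (f x)) -{1}(sK (f y)).
  by rewrite sub_inversions_mull //; apply/asc/surj; [exists x | exists y].
split=> -[surj ord].
  have surj' := surjE.1 surj; split=> // x y.
  exact: iff_trans (ord x y) (le x y surj').
split=> [|x y]; first exact: surjE.2 surj.
exact: iff_trans (ord x y) (iff_sym (le x y surj)).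
Qed.

End LeftMultiplication.

(** * Biclosed sets of pairs are inversion sets *)

Section Biclosed.
Local Open Scope nat_scope.

Lemma inversions_trans n (u : 'S_n) x y z :
  (x, y) \in inversions u -> (y, z) \in inversions u -> (x, z) \in inversions u.
Proof. by rewrite !in_inversions; lia. Qed.

Lemma inversions_cotrans n (u : 'S_n) (x y z : 'I_n) : x < y -> y < z ->
  (x, z) \in inversions u -> ((x, y) \in inversions u) || ((y, z) \in inversions u).
Proof. by rewrite !in_inversions; lia. Qed.

(* The permutation ranks the points for the total order which reverses the
   natural order exactly on the pairs in [J]. *)
Lemma biclosed_inversions n (J : {set 'I_n * 'I_n}) :
  (forall x y, (x, y) \in J -> x < y) ->
  (forall x y z, (x, y) \in J -> (y, z) \in J -> (x, z) \in J) ->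
  (forall x y z : 'I_n, x < y -> y < z ->
     (x, z) \in J -> ((x, y) \in J) || ((y, z) \in J)) ->
  exists u : 'S_n, inversions u = J.
Proof.
move=> ltJ trJ coJ.
pose R (x y : 'I_n) := if x < y then (x, y) \notin J else (y, x) \in J.
have Rirr x : R x x = false.
  by rewrite /R ltnn; apply/negP => /ltJ; rewrite ltnn.
have Ras x y : R x y -> R y x -> False.
  rewrite /R; case: ltngtP => [_ /negP//|_ + /negP//|/val_inj-> _].
  by move/ltJ; rewrite ltnn.
have Rto x y : x != y -> R x y || R y x.
  by rewrite -val_eqE /R; case: ltngtP => //= _ _; case: (_ \in J).
have Rtr y x z : R x y -> R y z -> R x z.
  have [->//|nxy] := eqVneq x y; have [->//|nyz] := eqVneq y z.
  have [-> Rzy /(Ras _ _ Rzy)//|nxz] := eqVneq x z.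
  move: nxy nyz nxz; rewrite -!val_eqE /R.
  (* One case per relative order of the three points, each settled by transitivity or cotransitivity
     of [J]. *)
  case: (ltngtP x y) => // lxy _; case: (ltngtP y z) => // lyz _;
    case: (ltngtP x z) => // lxz _; try by move: (lxy) (lyz) (lxz); lia.
  - move=> /negPf nxy /negPf nyz; apply/negP => /(coJ _ _ _ lxy lyz).
    by rewrite nxy nyz.
  - by move=> /negP nxy zyJ; apply/negP => xzJ; apply: nxy; apply: trJ zyJ.
  - by move=> /negPf nxy /(coJ _ _ _ lxz lxy); rewrite nxy orbF.
  - by move=> yxJ /negP nyz; apply/negP => xzJ; apply: nyz; apply: trJ xzJ.
  - by move=> /(coJ _ _ _ lyz lxz) + /negPf nyz; rewrite nyz.
  - by move=> yxJ zyJ; apply: trJ yxJ.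
(* The number of predecessors grows strictly along [R], hence is injective. *)
pose rk x := #|[set y | R y x]|.
have rk_lt x y : R x y -> rk x < rk y.
  move=> Rxy; apply: proper_card; apply/properP; split.
    by apply/subsetP => z; rewrite !inE => /Rtr; apply.
  by exists x; rewrite inE ?Rirr.
have rk_ltn x : rk x < n.
  rewrite -[X in _ < X]card_ord -cardsT; apply: proper_card; apply/properP.
  by split; [exact: subsetT | exists x; rewrite inE ?Rirr].
have rk_inj : injective (fun x => Ordinal (rk_ltn x)).
  move=> x y /(congr1 val) /= e; apply/eqP; apply: contraT => /Rto.
  by case/orP=> /rk_lt; rewrite e ltnn.
exists (perm rk_inj); apply/setP => -[x y]; rewrite in_inversions !permE /=.
case: ltnP => [lxy|lyx] /=; last by apply/esym/negP => /ltJ; rewrite ltnNge lyx.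
have [xyJ|nxyJ] := boolP ((x, y) \in J).
  by apply: rk_lt; rewrite /R ltnNge ltnW.
by apply/negbTE; rewrite -leqNgt ltnW // rk_lt // /R lxy.
Qed.

End Biclosed.

(** * Distributivity below a 321-avoiding permutation *)

Section Avoidance.
Local Open Scope nat_scope.

(** A 321 pattern is a chain of two inversions sharing their middle position. *)
Definition avoids321 n (u : 'S_n) : bool :=
  [forall p, forall q, forall r,
     ~~ (((p, q) \in inversions u) && ((q, r) \in inversions u))].

Lemma avoids321P n (u : 'S_n) :
  reflect (forall p q r, (p, q) \in inversions u -> (q, r) \notin inversions u)
          (avoids321 u).
Proof.
apply: (iffP forallP) => [av p q r pqI|av p].
  by have /forallP/(_ q)/forallP/(_ r) := av p; rewrite pqI.
apply/forallP => q; apply/forallP => r; rewrite negb_and -implybE.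
exact/implyP/av.
Qed.

(* Below a 321-avoiding permutation transitivity is void, and cotransitivity
   only says that (x, z) forces the one of (x, y), (y, z) inverted by [v]; such
   conditions are preserved by unions and intersections. *)
Lemma avoids321_cotrans n (v u : 'S_n) (x y z : 'I_n) :
  avoids321 v -> inversions u \subset inversions v -> x < y -> y < z ->
  (x, z) \in inversions u ->
  ((x, y) \in inversions u) = ((x, y) \in inversions v) /\
  ((y, z) \in inversions u) = ((y, z) \in inversions v).
Proof.
move=> /avoids321P av /subsetP sub lxy lyz xzI.
have := inversions_cotrans lxy lyz xzI.
case: (boolP ((x, y) \in inversions u)) => [xyI _|_ /= yzI].
  rewrite (sub _ xyI) (negPf (av _ _ z (sub _ xyI))); split=> //.
  by apply: contraNF (av _ _ z (sub _ xyI)) => /sub.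
rewrite yzI (sub _ yzI); split=> //; apply/esym/negP => /(av x y z).
by rewrite sub.
Qed.

(** Two inversions of the union never chain, as both lie in [v]; cotransitivity comes from the
    member that contains the pair. *)
Lemma avoids321_inversionsU n (v u1 u2 : 'S_n) :
  avoids321 v -> inversions u1 \subset inversions v ->
  inversions u2 \subset inversions v ->
  exists u : 'S_n, inversions u = inversions u1 :|: inversions u2.
Proof.
move=> av sub1 sub2; apply: biclosed_inversions => [x y|x y z|x y z lxy lyz].
- by rewrite in_setU !in_inversions; lia.
- have subU : inversions u1 :|: inversions u2 \subset inversions v.
    by rewrite subUset sub1.
  move=> /(subsetP subU) xyI /(subsetP subU).
  by move/avoids321P: av => /(_ _ _ z xyI) /negPf->.
- by rewrite !in_setU => /orP[/(inversions_cotrans lxy lyz)|/(inversions_cotrans lxy lyz)]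
    /orP[]->; rewrite ?orbT.
Qed.

(** If both sets contain [(x, z)], each splits it as [v] does, so they agree on the two shorter
    pairs. *)
Lemma avoids321_inversionsI n (v u1 u2 : 'S_n) :
  avoids321 v -> inversions u1 \subset inversions v ->
  inversions u2 \subset inversions v ->
  exists u : 'S_n, inversions u = inversions u1 :&: inversions u2.
Proof.
move=> av sub1 sub2; apply: biclosed_inversions => [x y|x y z|x y z lxy lyz].
- by rewrite in_setI !in_inversions; lia.
- rewrite !in_setI => /andP[xy1 xy2] /andP[yz1 yz2].
  by rewrite (inversions_trans xy1 yz1) (inversions_trans xy2 yz2).
- rewrite !in_setI => /andP[xz1 xz2].
  have [-> ->] := avoids321_cotrans av sub1 lxy lyz xz1.
  have [<- <-] := avoids321_cotrans av sub2 lxy lyz xz2.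
  by rewrite !andbb; apply: inversions_cotrans lxy lyz xz2.
Qed.

(** The proof [av] indexes the type so that the lattice instance built from it can be inferred. *)
Definition weak_ideal n (v : 'S_n) (av : avoids321 v) : Type :=
  {u : 'S_n | inversions u \subset inversions v}.

Section WeakIdeal.
Variables (n : nat) (v : 'S_n) (av : avoids321 v).
Implicit Types a b c : weak_ideal av.

HB.instance Definition _ := Choice.copy (weak_ideal av)
  {u : 'S_n | inversions u \subset inversions v}.

(** Turns the lattice laws below into identities of sets. *)
Lemma weak_ideal_inj a b : inversions (val a) = inversions (val b) -> a = b.
Proof. by move/inversions_inj/val_inj. Qed.

Lemma weak_ideal_meet_ex a b :
  exists c, inversions (val c) = inversions (val a) :&: inversions (val b).
Proof.
have [u uE] := avoids321_inversionsI av (valP a) (valP b).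
have sub : inversions u \subset inversions v.
  by rewrite uE; apply: subset_trans (subsetIl _ _) (valP a).
by exists (exist _ u sub).
Qed.

Lemma weak_ideal_join_ex a b :
  exists c, inversions (val c) = inversions (val a) :|: inversions (val b).
Proof.
have [u uE] := avoids321_inversionsU av (valP a) (valP b).
have sub : inversions u \subset inversions v.
  by rewrite uE subUset (valP a) (valP b).
by exists (exist _ u sub).
Qed.

(** The element with the prescribed inversion set is only known to exist, so [cid] picks it;
    [weak_ideal_inj] makes it unique. *)
Definition weak_ideal_meet a b := projT1 (cid (weak_ideal_meet_ex a b)).
Definition weak_ideal_join a b := projT1 (cid (weak_ideal_join_ex a b)).
Definition weak_ideal_le a b := inversions (val a) \subset inversions (val b).

Lemma inversions_meet a b : inversions (val (weak_ideal_meet a b))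
  = inversions (val a) :&: inversions (val b).
Proof. exact: projT2 (cid (weak_ideal_meet_ex a b)). Qed.

Lemma inversions_join a b : inversions (val (weak_ideal_join a b))
  = inversions (val a) :|: inversions (val b).
Proof. exact: projT2 (cid (weak_ideal_join_ex a b)). Qed.

Let invE := (inversions_meet, inversions_join).

Lemma weak_ideal_le_def a b : weak_ideal_le a b = (weak_ideal_meet a b == a).
Proof.
apply/setIidPl/eqP => [e|/(congr1 (fun c => inversions (val c)))].
  by apply: weak_ideal_inj; rewrite invE.
by rewrite invE.
Qed.

Lemma weak_ideal_meetC : commutative weak_ideal_meet.
Proof. by move=> a b; apply: weak_ideal_inj; rewrite !invE setIC. Qed.

Lemma weak_ideal_joinC : commutative weak_ideal_join.
Proof. by move=> a b; apply: weak_ideal_inj; rewrite !invE setUC. Qed.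

Lemma weak_ideal_meetA : associative weak_ideal_meet.
Proof. by move=> a b c; apply: weak_ideal_inj; rewrite !invE setIA. Qed.

Lemma weak_ideal_joinA : associative weak_ideal_join.
Proof. by move=> a b c; apply: weak_ideal_inj; rewrite !invE setUA. Qed.

Lemma weak_ideal_joinKI b a : weak_ideal_meet a (weak_ideal_join a b) = a.
Proof.
apply: weak_ideal_inj; rewrite !invE setIUr setIid setUC setIC.
by apply/setUidPr; rewrite subsetIr.
Qed.

Lemma weak_ideal_meetKU b a : weak_ideal_join a (weak_ideal_meet a b) = a.
Proof.
by apply: weak_ideal_inj; rewrite !invE; apply/setUidPl; rewrite subsetIl.
Qed.

Lemma weak_ideal_meetUl : left_distributive weak_ideal_meet weak_ideal_join.
Proof. by move=> a b c; apply: weak_ideal_inj; rewrite !invE setIUl. Qed.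

Lemma weak_ideal_meetxx : idempotent_op weak_ideal_meet.
Proof. by move=> a; apply: weak_ideal_inj; rewrite !invE setIid. Qed.

HB.instance Definition _ := Order.isMeetJoinDistrLattice.Build (Order.Disp tt tt)
  (weak_ideal av) weak_ideal_le_def (fun _ _ => erefl)
  weak_ideal_meetC weak_ideal_joinC weak_ideal_meetA weak_ideal_joinA
  weak_ideal_joinKI weak_ideal_meetKU weak_ideal_meetUl weak_ideal_meetxx.

End WeakIdeal.

Lemma avoids321_distributive n (k : 'I_n.-1) (v : 'S_n) :
  v (lo k) < v (hi k) -> avoids321 v ->
  distributive_interval (sigma k) (sigma k * v)%g.
Proof.
move=> asc av; exists (Order.Disp tt tt), (weak_ideal av : distrLatticeType _).
exists (fun a => sigma k * val a)%g; apply/weak_interval_iso_sigma => //.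
split=> [u|a b]; last by rewrite !mulgA sigmaK !mul1g.
split=> [sub|[a <-]]; last by rewrite mulgA sigmaK mul1g (valP a).
by exists (exist _ u sub); rewrite mulgA sigmaK mul1g.
Qed.

Lemma distributive_modular n (v w : 'S_n) :
  distributive_interval v w -> modular_interval v w.
Proof.
move=> [d [L [f iso]]]; exists d, L, f; split=> // x y z lexz.
by rewrite Order.DistrLatticeTheory.joinIr (Order.JoinTheory.join_idPr lexz).
Qed.

End Avoidance.

(** * A 321 pattern violates the modular law *)

Section Hexagon.
Local Open Scope nat_scope.

Lemma inversions_mulr_at n (u : 'S_n) (i : 'I_n.-1) (p q : 'I_n) :
  p < q -> u p = hi i -> u q = lo i ->
  inversions (u * sigma i)%g = inversions u :\ (p, q).
Proof.
move=> lpq up uq; have := @inversions_mulr_desc n u i.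
by rewrite -up -uq !permK => /(_ lpq).
Qed.

(** The value just above [u y] sits either left of [y], giving the descent, or right of it, giving
    an inversion with [x] of smaller gap. *)
Lemma value_descent n (u : 'S_n) (x y : 'I_n) : (x, y) \in inversions u ->
  exists i : 'I_n.-1, [/\ u y <= lo i, hi i <= u x &
                          (u^-1)%g (hi i) < (u^-1)%g (lo i)].
Proof.
have [m] := ubnP (u x - u y); elim: m => // m IHm in y *.
rewrite in_inversions => lt_m /andP[lxy lu].
have lt_i : u y < n.-1 by case: (u x) lu => /= a; lia.
pose i := Ordinal lt_i; have uyE : u y = lo i by apply: val_inj.
pose z := (u^-1)%g (hi i); have uzE : u z = hi i by rewrite permKV.
have luz : (u z : nat) = (u y).+1 by rewrite uzE.
case: (ltngtP z y) => [lzy|lyz|/val_inj ezy].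
- by exists i; rewrite -uyE permK -uzE permK luz leqnn lu lzy.
- have xzI : (x, z) \in inversions u.
    rewrite in_inversions (ltn_trans lxy lyz) ltn_neqAle luz lu andbT.
    rewrite -luz; apply/eqP => /val_inj/perm_inj e.
    by move: lyz lxy; rewrite e; lia.
  have [|j [le1 le2 dj]] := IHm z _ xzI; first by rewrite luz; lia.
  by exists j; split=> //; apply: leq_trans le1; rewrite luz.
- by move: luz; rewrite ezy => /eqP; rewrite ltn_eqF.
Qed.

(* In a minimal permutation containing the pattern, undoing a descent must
   destroy the pattern, so the three values of the pattern are consecutive. *)
Lemma minimal_321 n (u : 'S_n) : ~~ avoids321 u ->
  (forall t : 'S_n, inversions t \proper inversions u -> avoids321 t) ->
  exists (i j : 'I_n.-1) (p q r : 'I_n),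
    [/\ hi i = lo j, p < q, q < r & [/\ u p = hi j, u q = hi i & u r = lo i]].
Proof.
move=> nav min.
have [p [q [r [pqI qrI]]]] :
    exists p q r : 'I_n, (p, q) \in inversions u /\ (q, r) \in inversions u.
  move: nav; rewrite negb_forall => /existsP[p]; rewrite negb_forall.
  move=> /existsP[q]; rewrite negb_forall => /existsP[r].
  by rewrite negbK => /andP[? ?]; exists p, q, r.
(* Undoing a descent removes one inversion and, by minimality, breaks the pattern, so it removes
   [(p, q)] or [(q, r)]. *)
have descP i : (u^-1)%g (hi i) < (u^-1)%g (lo i) ->
    (u p = hi i /\ u q = lo i) \/ (u q = hi i /\ u r = lo i).
  move=> desc; have invE := inversions_mulr_desc desc.
  have : avoids321 (u * sigma i)%g.
    by apply: min; rewrite invE properD1 // in_inversions desc !permKV /= ltnSn.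
  move/avoids321P/(_ p q r); rewrite invE !in_setD1 pqI qrI !andbT.
  case: eqVneq => [[-> ->] _|_ /(_ isT)]; first by left; rewrite !permKV.
  by rewrite negbK => /eqP[-> ->]; right; rewrite !permKV.
(* A descent between the values at [q] and [r] can only be that pair itself, so these values are
   consecutive; likewise for [p] and [q]. *)
have [i [lei1 lei2 di]] := value_descent qrI.
have [j [lej1 lej2 dj]] := value_descent pqI.
have [[lpq lupq] [lqr luqr]] : (p < q /\ u q < u p) /\ (q < r /\ u r < u q).
  by move: pqI qrI; rewrite !in_inversions => /andP[-> ->] /andP[-> ->].
have [[up _]|[uq ur]] := descP i di.
  by move: lupq; rewrite up ltnNge lei2.
have [[up uq']|[_ ur']] := descP j dj; last first.
  by move: luqr; rewrite ur' ltnNge lej1.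
by exists i, j, p, q, r; split=> //; rewrite -uq -uq'.
Qed.

(** The hexagon contains a pentagon: [X < Z], while [Y] meets [Z] below [X] and joins [X] above
    [Z]. *)
Lemma modular_avoids321 n (k : 'I_n.-1) (v : 'S_n) :
  v (lo k) < v (hi k) -> modular_interval (sigma k) (sigma k * v)%g ->
  avoids321 v.
Proof.
move=> asc [d [L [f [modL /(weak_interval_iso_sigma _ asc) [surj ord]]]]].
apply: contraT => nav.
pose P (u : 'S_n) := (inversions u \subset inversions v) && ~~ avoids321 u.
have Pv : P v by rewrite /P subxx.
have [u /andP[subu navu] minu] := arg_minnP (@ninv n) Pv.
have [t|i [j [p [q [r [eij lpq lqr [up uq ur]]]]]]] := minimal_321 navu.
  move=> ltu; apply: contraT => navt.
  have := minu t; rewrite /P navt (subset_trans (proper_sub ltu) subu).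
  by move=> /(_ isT); rewrite leqNgt proper_card.
have lpr : p < r := ltn_trans lpq lqr.
(* The two ways down from [u]: [z] loses [(q, r)] and [x] also [(p, r)]; [t] loses [(p, q)] and [y]
   also [(p, r)]. *)
pose z := (u * sigma i)%g; pose x := (z * sigma j)%g.
pose t := (u * sigma j)%g; pose y := (t * sigma i)%g.
have sfix : sigma i (hi j) = hi j.
  apply: ord_inj; rewrite val_sigma; move/(congr1 val): eij => /=.
  by case: eqVneq => ?; [lia|case: eqVneq => ? //; lia].
have sfix' : sigma j (lo i) = lo i.
  apply: ord_inj; rewrite val_sigma; move/(congr1 val): eij => /=.
  by case: eqVneq => ?; [lia|case: eqVneq => ? //; lia].
have zE : inversions z = inversions u :\ (q, r) by apply: inversions_mulr_at.
have xE : inversions x = inversions z :\ (p, r).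
  by apply: inversions_mulr_at; rewrite // permM ?up ?ur ?sfix ?sigma_lo.
have tE : inversions t = inversions u :\ (p, q).
  by apply: inversions_mulr_at; rewrite // uq.
have yE : inversions y = inversions t :\ (p, r).
  by apply: inversions_mulr_at; rewrite // permM ?up ?ur ?sfix' ?sigma_hi.
have inj_of w : inversions w \subset inversions u -> exists a, (sigma k * f a)%g = w.
  by move=> sub; apply/surj/(subset_trans sub).
have [Z ZE] : exists a, (sigma k * f a)%g = z by apply: inj_of; rewrite zE subD1set.
have [X XE] : exists a, (sigma k * f a)%g = x.
  by apply: inj_of; rewrite xE (subset_trans (subD1set _ _)) // zE subD1set.
have [Y YE] : exists a, (sigma k * f a)%g = y.
  by apply: inj_of; rewrite yE (subset_trans (subD1set _ _)) // tE subD1set.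
have leXZ : (X <= Z)%O by apply/ord; rewrite XE ZE xE subD1set.
(* The meet lacks [(p, r)] because [Y] does, and [(q, r)] because [Z] does. *)
have leIX : (Y `&` Z <= X)%O.
  have /ord := Order.MeetTheory.leIl Y Z; rewrite YE => /subsetP subY.
  have /ord := Order.MeetTheory.leIr Z Y; rewrite ZE => /subsetP subZ.
  apply/ord/subsetP => e eI; move: (subY e eI) (subZ e eI).
  by rewrite XE yE tE xE zE !in_setD1 => /and3P[-> _ _].
(* The join gets [(p, q)] from [X] and [(q, r)] from [Y], so transitivity forces [(p, r)] into
   it. *)
have leZU : (Z <= X `|` Y)%O.
  have /ord := Order.JoinTheory.leUl X Y; rewrite XE => /subsetP subX.
  have /ord := Order.JoinTheory.leUr Y X; rewrite YE => /subsetP subY.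
  have neq (a b c e : 'I_n) : (a != c) || (b != e) -> (a, b) != (c, e).
    by rewrite xpair_eqE negb_and.
  have npq : p != q by rewrite -val_eqE neq_ltn lpq.
  have nqr : q != r by rewrite -val_eqE neq_ltn lqr.
  have pqI : (p, q) \in inversions u.
    by rewrite in_inversions lpq uq up eij /= ltnSn.
  have qrI : (q, r) \in inversions u by rewrite in_inversions lqr uq ur /= ltnSn.
  apply/ord/subsetP => e; rewrite ZE zE in_setD1 => /andP[ne eI].
  have [->|ne'] := eqVneq e (p, r).
    apply: (@inversions_trans _ _ _ q).
      by apply: subX; rewrite xE zE !in_setD1 pqI !neq ?npq ?nqr ?orbT.
    by apply: subY; rewrite yE tE !in_setD1 qrI !neq // eq_sym npq ?orbT.
  by apply: subX; rewrite xE zE !in_setD1 ne ne'.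
(* The modular law now reads [X = Z], but only [Z] has the inversion [(p, r)]. *)
have := modL X Y Z leXZ.
rewrite (Order.JoinTheory.join_idPl leIX) (Order.MeetTheory.meet_idPr leZU) => eXZ.
have : (p, r) \in inversions z.
  rewrite zE in_setD1 xpair_eqE negb_and -val_eqE neq_ltn lpq in_inversions lpr.
  by rewrite up ur; move/(congr1 val): eij => /= eij; lia.
by rewrite -ZE -eXZ XE xE in_setD1 eqxx.
Qed.

End Hexagon.

(** * Counting 321-avoiding permutations *)

Section Counting.
Local Open Scope nat_scope.

(** The bound is a number rather than a position, which allows the empty suffix [j = n]. *)
Definition sorted_from j n (u : 'S_n) : bool :=
  [forall p : 'I_n, forall q : 'I_n, (j <= p) ==> ((p, q) \notin inversions u)].

(** As a number, [k] survives the change of size in the recursion; the predicate is false when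
    [k.+1] is not a position. *)
Definition descent_at k n (u : 'S_n) : bool :=
  [exists p : 'I_n, exists q : 'I_n,
     [&& p == k :> nat, q == k.+1 :> nat & (p, q) \in inversions u]].

Lemma sorted_fromP j n (u : 'S_n) :
  reflect (forall p q : 'I_n, j <= p -> (p, q) \notin inversions u)
          (sorted_from j u).
Proof.
apply: (iffP forallP) => [so p q lejp|so p].
  by have /forallP/(_ q) := so p; rewrite lejp.
by apply/forallP => q; apply/implyP/so.
Qed.

Lemma descent_atP k n (u : 'S_n) :
  reflect (exists p q : 'I_n,
             [/\ (p : nat) = k, (q : nat) = k.+1 & (p, q) \in inversions u])
          (descent_at k u).
Proof.
apply: (iffP existsP) => [[p /existsP[q /and3P[/eqP pk /eqP qk I]]]|[p [q [pk qk I]]]].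
  by exists p, q.
by exists p; apply/existsP; exists q; rewrite pk qk I !eqxx.
Qed.

Lemma sorted_from_last n (u : 'S_n.+1) : sorted_from n u.
Proof.
apply/sorted_fromP => p q lenp; rewrite in_inversions.
by have := ltn_ord p; have := ltn_ord q; lia.
Qed.

Lemma sorted_from_all n (u : 'S_n) : sorted_from n u.
Proof. by apply/sorted_fromP => p q; rewrite leqNgt ltn_ord. Qed.

Definition insert_max n (i : 'I_n.+1) (u : 'S_n) : 'S_n.+1 :=
  lift_perm i ord_max u.

Lemma insert_max_inj n (i j : 'I_n.+1) (u v : 'S_n) :
  insert_max i u = insert_max j v -> i = j /\ u = v.
Proof.
move=> e; have eij : i = j.
  apply: (@perm_inj _ (insert_max i u)).
  by rewrite {2}e !lift_perm_id.
split=> //; apply/permP => a; apply: (@lift_inj _ ord_max).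
by rewrite -!(lift_perm_lift i) -/(insert_max i u) e eij.
Qed.

(** Insertion is injective, hence bijective because [(n+1) * n! = (n+1)!]. *)
Lemma card_insert_max n (P : pred 'S_n.+1) :
  #|[set w | P w]| = \sum_(i < n.+1) #|[set u : 'S_n | P (insert_max i u)]|.
Proof.
pose F (iu : 'I_n.+1 * 'S_n) := insert_max iu.1 iu.2.
have F_inj : injective F.
  by move=> [i u] [j v] /insert_max_inj[/= -> ->].
have F_bij : bijective F.
  by apply: inj_card_bij F_inj _; rewrite card_prod card_ord !card_Sn factS.
rewrite -sum1_card (reindex F) /=; last exact: onW_bij.
rewrite (eq_bigr (fun i => \sum_(u | P (insert_max i u)) 1)); last first.
  by move=> i _; rewrite -sum1_card; apply: eq_bigl => u; rewrite inE.
rewrite pair_big_dep /=; apply: eq_bigl => -[i u].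
by rewrite inE.
Qed.

Lemma ltn_bump_self h k : (h < bump h k) = (h <= k).
Proof. by rewrite /bump; case: (leqP h k); lia. Qed.

Lemma leq_of_leq_bump h j k : h < j -> j <= bump h k -> h <= k.
Proof. by rewrite /bump; case: (leqP h k); lia. Qed.

Lemma bump_eq_small h m k : m < h -> bump h k = m -> k = m.
Proof. by rewrite /bump; case: (leqP h k); lia. Qed.

Lemma inversions_insert_lift n (i : 'I_n.+1) (u : 'S_n) a b :
  ((lift i a, lift i b) \in inversions (insert_max i u))
    = ((a, b) \in inversions u).
Proof.
rewrite !in_inversions /insert_max !lift_perm_lift !lift_max /=.
by rewrite ltnNge leq_bump2 -ltnNge.
Qed.

Lemma inversions_insert_max n (i : 'I_n.+1) (u : 'S_n) b :
  ((i, lift i b) \in inversions (insert_max i u)) = (i <= b).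
Proof.
rewrite in_inversions /insert_max lift_perm_lift lift_perm_id lift_max /= ltn_ord.
by rewrite andbT ltn_bump_self.
Qed.

Lemma inversions_insert_notr n (i p : 'I_n.+1) (u : 'S_n) :
  (p, i) \notin inversions (insert_max i u).
Proof.
rewrite in_inversions /insert_max lift_perm_id /= negb_and -!leqNgt.
by rewrite -[X in _ || X]ltnS ltn_ord orbT.
Qed.

(** The maximal value can only be the 3 of a pattern, and it is one exactly when an inversion starts
    after it. *)
Lemma avoids321_insert n (i : 'I_n.+1) (u : 'S_n) :
  avoids321 (insert_max i u) = avoids321 u && sorted_from i u.
Proof.
apply/avoids321P/andP => [av|[/avoids321P av /sorted_fromP so] p q r].
  split; last first.
    apply/sorted_fromP => p q leip; rewrite -(inversions_insert_lift i).
    by apply: (av i); rewrite inversions_insert_max.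
  apply/avoids321P => p q r; rewrite -!(inversions_insert_lift i).
  exact: av.
case: (unliftP i q) => [b ->|->];
    last by rewrite (negPf (inversions_insert_notr _ _ _)).
case: (unliftP i r) => [c ->|->]; last by rewrite inversions_insert_notr.
case: (unliftP i p) => [a ->|->].
  by rewrite !inversions_insert_lift; apply: av.
by rewrite inversions_insert_max inversions_insert_lift; apply: so.
Qed.

Lemma sorted_from_insert_lt j n (i : 'I_n.+1) (u : 'S_n) :
  i < j -> sorted_from i u -> sorted_from j (insert_max i u).
Proof.
move=> lij /sorted_fromP so; apply/sorted_fromP => p q lejp.
case: (unliftP i q) => [b ->|->]; last by rewrite inversions_insert_notr.
case: (unliftP i p) lejp => [a ->|->]; last by rewrite leqNgt lij.
rewrite inversions_insert_lift /= => le; apply: so.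
exact: leq_of_leq_bump lij le.
Qed.

Lemma sorted_from_insert_ge j n (i : 'I_n.+1) (u : 'S_n) :
  j <= i -> sorted_from j (insert_max i u) = (i == n :> nat) && sorted_from j u.
Proof.
move=> leji; apply/sorted_fromP/andP => [so|[/eqP ein /sorted_fromP so] p q lejp].
  split.
    case: (ltngtP i n) => // [lin|]; last by rewrite ltnNge -ltnS ltn_ord.
    have := so i (lift i (Ordinal lin)) leji.
    by rewrite inversions_insert_max leqnn.
  apply/sorted_fromP => p q lejp; rewrite -(inversions_insert_lift i).
  by apply: so; rewrite /= /bump (leq_trans lejp) ?leq_addl.
case: (unliftP i q) => [b ->|->]; last by rewrite inversions_insert_notr.
case: (unliftP i p) lejp => [a ->|->].
  rewrite inversions_insert_lift /= /bump ein [n <= a]leqNgt (ltn_ord a : a < n).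
  exact: so.
by rewrite inversions_insert_max ein -ltnNge (ltn_ord b : b < n).
Qed.

(** Inserted before [k], the maximal value shifts the sorted suffix onto [k] and [k+1]; at [k] it
    starts a descent unless it is last; at [k+1] it ends an ascent; further right it leaves both
    positions alone. *)
Lemma descent_at_insert k n (i : 'I_n.+1) (u : 'S_n) : sorted_from i u ->
  descent_at k (insert_max i u) =
  if i < k then false else if i == k :> nat then k < n else
  if i == k.+1 :> nat then false else descent_at k u.
Proof.
move=> /sorted_fromP so; apply/descent_atP.
case: (ltngtP i k) => [lik|lki|eik].
- move=> [p [q [pk qk]]].
  case: (unliftP i q) qk => [b ->|->];
    last by rewrite (negPf (inversions_insert_notr _ _ _)).
  case: (unliftP i p) pk => [a ->|-> ik]; last by move: lik; rewrite ik ltnn.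
  rewrite inversions_insert_lift /= => ak _; apply/negP/so.
  by apply: leq_of_leq_bump lik _; rewrite ak.
- case: eqVneq => [ik|nik].
    move=> [p [q [pk qk]]].
    have -> : q = i by apply: ord_inj; rewrite qk ik.
    by rewrite (negPf (inversions_insert_notr _ _ _)).
  have lkSi : k.+1 < i by rewrite ltn_neqAle eq_sym nik.
  case: (descent_atP k u) => [[p [q [pk qk I]]]|nd].
    exists (lift i p), (lift i q); rewrite inversions_insert_lift /= /bump pk qk.
    by split=> //; rewrite leqNgt ?lki ?lkSi.
  move=> [p [q [pk qk I]]]; apply: nd.
  case: (unliftP i q) qk I => [b ->|->];
    last by rewrite (negPf (inversions_insert_notr _ _ _)).
  case: (unliftP i p) pk => [a ->|-> pk]; last by move: lki; rewrite pk ltnn.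
  rewrite inversions_insert_lift /= => ak bk I; exists a, b.
  by split=> //; [exact: bump_eq_small ak | exact: bump_eq_small bk].
- case: (ltnP k n) => [lkn|lenk].
    exists i, (lift i (Ordinal lkn)).
    by rewrite inversions_insert_max /= /bump eik leqnn.
  move=> [p [q [_ qk _]]].
  by have := ltn_ord q; rewrite qk ltnS ltnNge lenk.
Qed.

(** These are the ballot numbers. *)
Definition num_sorted n j : nat :=
  #|[set u : 'S_n | avoids321 u && sorted_from j u]|.

Definition num_descent k n j : nat :=
  #|[set u : 'S_n | [&& avoids321 u, sorted_from j u & descent_at k u]]|.

Lemma num_sorted_last n : num_sorted n.+1 n.+1 = num_sorted n.+1 n.
Proof.
by apply: eq_card => u; rewrite !inE sorted_from_all sorted_from_last.
Qed.

(** The maximal value at [i < j] gives [num_sorted n i]; within the suffix it must come last, which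
    gives the term [num_sorted n j]. *)
Lemma num_sortedS n j : j <= n ->
  num_sorted n.+1 j = \sum_(0 <= i < j.+1) num_sorted n i.
Proof.
move=> lejn; rewrite /num_sorted card_insert_max.
pose T i := if i < j then num_sorted n i else if i == n then num_sorted n j else 0.
rewrite (eq_bigr (fun i : 'I_n.+1 => T i)) => [|i _]; last first.
  rewrite /T; case: ltnP => [lij|leji].
    apply: eq_card => u; rewrite !inE avoids321_insert.
    case: (boolP (sorted_from i u)) => so; rewrite ?andbF //.
    by rewrite sorted_from_insert_lt ?andbT.
  case: eqVneq => [ein|nein].
    apply: eq_card => u; rewrite !inE avoids321_insert sorted_from_insert_ge //.
    by rewrite ein sorted_from_all eqxx andbT.
  by apply: eq_card0 => u; rewrite !inE sorted_from_insert_ge // (negPf nein) andbF.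
transitivity (\sum_(0 <= i < n.+1) T i); first by rewrite big_mkord.
rewrite (big_cat_nat (n := j)) //=; last exact: leqW.
rewrite [RHS]big_nat_recr //=; congr (_ + _).
  by apply: eq_big_nat => i /andP[_ lij]; rewrite /T lij.
rewrite big_nat_recr //= {2}/T eqxx ltnNge lejn /= big1_seq // => i.
rewrite mem_index_iota => /and3P[_ leji lin].
by rewrite /T ltnNge leji (ltn_eqF lin).
Qed.

Lemma num_sortedSS n j : j < n ->
  num_sorted n.+1 j.+1 = num_sorted n.+1 j + num_sorted n j.+1.
Proof.
by move=> ltjn; rewrite (num_sortedS ltjn) (num_sortedS (ltnW ltjn)) big_nat_recr.
Qed.

(** Removing the maximal value leaves one term for position [k] and counts of the same kind in
    smaller size; by induction they add up to the ballot recursion of the right side. *)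
Lemma num_descentS k n j : k < j <= n ->
  num_descent k n.+1 j.+1 = num_sorted n j.
Proof.
elim: n j => [|n IHn] j /andP[ltkj lejn]; first by move: ltkj; lia.
have lekn : k <= n by rewrite -ltnS (leq_trans ltkj).
rewrite /num_descent card_insert_max; set m := n.+1.
(* [T i] is the contribution of the maximal value at position [i]. *)
pose T i := if i <= j then if i < k then 0 else if i == k then num_sorted m k
  else if i == k.+1 then 0 else num_descent k m i
  else if i == m then num_descent k m j.+1 else 0.
rewrite (eq_bigr (fun i : 'I_m.+1 => T i)) => [|i _]; last first.
  rewrite /T; case: (leqP i j) => [leij|ltji].
    case: (ltnP i k) => [lik|leki].
      apply: eq_card0 => u; rewrite !inE avoids321_insert.
      case: (boolP (sorted_from i u)) => so; rewrite ?andbF //.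
      by rewrite descent_at_insert // lik !andbF.
    case: eqVneq => [ik|nik].
      apply: eq_card => u; rewrite !inE avoids321_insert.
      case: (boolP (sorted_from i u)) => so; last by rewrite !andbF -ik (negPf so) andbF.
      rewrite descent_at_insert // sorted_from_insert_lt ?ltnS //.
      by rewrite ik ltnn eqxx lekn -ik so !andbT.
    case: eqVneq => [ik|nik'].
      apply: eq_card0 => u; rewrite !inE avoids321_insert.
      case: (boolP (sorted_from i u)) => so; rewrite ?andbF // descent_at_insert //.
      by rewrite ltnNge leki (negPf nik) ik eqxx !andbF.
    apply: eq_card => u; rewrite !inE avoids321_insert.
    case: (boolP (sorted_from i u)) => so; rewrite ?andbF // descent_at_insert //.
    by rewrite ltnNge leki (negPf nik) (negPf nik') sorted_from_insert_lt ?ltnS ?andbT.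
  case: eqVneq => [im|nim].
    apply: eq_card => u; rewrite !inE avoids321_insert sorted_from_insert_ge //.
    rewrite {1}im sorted_from_all im eqxx andbT descent_at_insert; last first.
      by rewrite im sorted_from_all.
    by rewrite ifN ?ifN //; lia.
  by apply: eq_card0 => u; rewrite !inE sorted_from_insert_ge // (negPf nim) /= ?andbF.
have sumD b : b <= n -> \sum_(k.+2 <= i < b.+2) num_descent k m i
    = \sum_(k.+1 <= i < b.+1) num_sorted n i.
  move=> lebn; rewrite big_add1 /=; apply: eq_big_nat => i /andP[lki lib].
  by rewrite IHn // lki /= (leq_trans _ lebn).
(* The term for position [k] supplies the initial segment of the sum. *)
have sumA b : k <= b -> b <= n ->
    num_sorted m k + \sum_(k.+1 <= i < b.+1) num_sorted n i
    = num_sorted m b.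
  by move=> lekb lebn; rewrite !num_sortedS // -big_cat_nat.
transitivity (\sum_(0 <= i < m.+1) T i); first by rewrite big_mkord.
rewrite (big_cat_nat (n := k.+2)) //=.
rewrite big_nat_recr //= big_nat_recr //=.
have -> : \sum_(0 <= i < k) T i = 0.
  rewrite big1_seq // => i; rewrite mem_index_iota => /andP[_ /= lik].
  by rewrite /T lik (leq_trans (ltnW lik) (ltnW ltkj)).
have -> : T k = num_sorted m k by rewrite /T (ltnW ltkj) ltnn eqxx.
have -> : T k.+1 = 0 by rewrite /T ltkj ltnNge leqnSn (gtn_eqF (ltnSn k)) eqxx.
have TE i : k.+1 < i -> i <= j -> T i = num_descent k m i.
  move=> lki lij; rewrite /T lij ltnNge (ltnW (ltnW lki)) /=.
  by rewrite (gtn_eqF (ltnW lki)) (gtn_eqF lki).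
(* For [j < m] the last position contributes the term of index [j+1]. For [j = m] it is already
   among the terms up to [j], and [num_sorted_last] bridges the indices [n] and [m]. *)
rewrite add0n addn0; case: (ltngtP j m) lejn => // [ltjm|ejm] _.
  rewrite (big_cat_nat (n := j.+1)) //= ?ltnS ?(ltnW ltjm) //.
  rewrite [X in _ + (_ + X)]big_nat_recr //=.
  rewrite [X in _ + (_ + (X + _))]big1_seq; last first.
    move=> i; rewrite mem_index_iota => /and3P[_ ltji ltim].
    by rewrite /T leqNgt ltji (ltn_eqF ltim).
  rewrite add0n {2}/T leqNgt ltjm eqxx /=.
  rewrite (eq_big_nat _ _ (F2 := num_descent k m)); last first.
    by move=> i /andP[lki lij]; apply: TE.
  by rewrite -(big_nat_recr j.+1) //= sumD // sumA // ltnW.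
rewrite (eq_big_nat _ _ (F2 := num_descent k m)); last first.
  by move=> i /andP[lki lij]; apply: TE; rewrite // ejm -ltnS.
by rewrite sumD // sumA // ejm /m num_sorted_last.
Qed.

(* 'C(m, j - 1), read as 0 for j = 0, where [j.-1] would give 'C(m, 0). *)
Definition bin_pred m j : nat := if j is j'.+1 then 'C(m, j') else 0.

Lemma bin_predS m j : bin_pred m.+1 j.+1 = bin_pred m j.+1 + bin_pred m j.
Proof. by case: j => [|j] /=; rewrite ?bin0 // binS. Qed.

(** Pascal's rule matches [num_sortedSS]. The form is additive to avoid truncated subtraction. *)
Lemma num_sorted_ballot n j : j <= n ->
  num_sorted n j + bin_pred (n + j) j = 'C(n + j, j).
Proof.
elim: n j => [|n IHn] j.
  rewrite leqn0 => /eqP->; rewrite addn0 bin0 /num_sorted.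
  have -> : 1 = #|[set: 'S_0]| by rewrite cardsT card_Sn.
  rewrite /= addn0.
  apply: eq_card => u; rewrite !inE sorted_from_all andbT.
  by apply/avoids321P => -[].
elim: j => [|j IHj] lej.
  by rewrite num_sortedS // big_nat1; have := IHn 0 (leq0n n); rewrite !bin0.
have {}IHj := IHj (ltnW lej).
rewrite addnS binS bin_predS.
move: (lej); rewrite ltnS leq_eqVlt => /orP[/eqP ejn|ltjn]; last first.
  have := IHn j.+1 ltjn; rewrite num_sortedSS // addnS -addSn -IHj.
  move: (bin_pred _ _) (bin_pred _ _) => b c; rewrite addSn => <-; lia.
(* On the diagonal [num_sorted_last] replaces the recursion and matches the symmetry of
   binomials. *)
rewrite ejn in IHj *; rewrite num_sorted_last.
have -> : 'C(n.+1 + n, n.+1) = 'C(n.+1 + n, n).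
  by rewrite -bin_sub ?leq_addr // addKn.
by rewrite [bin_pred _ n.+1]/= addnCA IHj.
Qed.

Lemma catalan_num_sorted n : catalan n = num_sorted n n.
Proof.
have := num_sorted_ballot (leqnn n); rewrite addnn -mul2n => e.
(* This ratio of neighbouring binomials turns the ballot difference into the Catalan quotient. *)
have eM : n.+1 * bin_pred (2 * n) n = n * 'C(2 * n, n).
  case: n {e} => [|n] //=; rewrite mul_bin_left; congr (_ * _); lia.
rewrite /catalan; suff -> : 'C(2 * n, n) = n.+1 * num_sorted n n by rewrite mulKn.
by move: eM; rewrite -e; nia.
Qed.
End Counting.

(** * Ascents at [k] and the count of intervals *)

Lemma descent_at_lo_hi n (k : 'I_n.-1) (v : 'S_n) :
  descent_at k v = (v (hi k) < v (lo k))%N.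
Proof.
apply/descent_atP/idP => [[p [q [pk qk]]]|desc]; last first.
  by exists (lo k), (hi k); rewrite in_inversions desc /= ltnSn.
have -> : p = lo k by apply: ord_inj.
have -> : q = hi k by apply: ord_inj.
by rewrite in_inversions => /andP[].
Qed.

Lemma card_avoids321_ascent n (k : 'I_n.-1) :
  #|[set v : 'S_n | avoids321 v && ~~ descent_at k v]|
    = (catalan n - catalan n.-1)%N.
Proof.
case: n k => [[]//|n] k; rewrite !catalan_num_sorted.
(* At [j = n] both suffix conditions hold trivially, so the Catalan number one below the size counts
   the descents at [k]. *)
rewrite -(@num_descentS k n n) ?leqnn ?andbT; last exact: (ltn_ord k).
rewrite /num_sorted /num_descent -cardsDS.
  apply: eq_card => v; rewrite !inE !sorted_from_all.
  by case: avoids321; rewrite ?andbT ?andbF.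
by apply/subsetP => v; rewrite !inE => /and3P[-> ->].
Qed.

Theorem theorem5p11 (n : nat) (k : 'I_n.-1) :
  (forall w : 'S_n, weak_le (sigma k) w ->
     (distributive_interval (sigma k) w <-> modular_interval (sigma k) w)) /\
  #|[set w : 'S_n | `[< weak_le (sigma k) w /\
                        distributive_interval (sigma k) w >]]|
    = (catalan n - catalan n.-1)%N.
Proof.
have sK w : (sigma k * (sigma k * w))%g = w by rewrite mulgA sigmaK mul1g.
have ascP w : weak_le (sigma k) w <->
    ((sigma k * w)%g (lo k) < (sigma k * w)%g (hi k))%N.
  by rewrite sigma_weak_le !permM sigma_lo sigma_hi.
have modular_av w : weak_le (sigma k) w -> modular_interval (sigma k) w ->
    avoids321 (sigma k * w)%g.
  by move=> /ascP asc; rewrite -{1}[w]sK; apply: modular_avoids321.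
have av_distributive w : weak_le (sigma k) w -> avoids321 (sigma k * w)%g ->
    distributive_interval (sigma k) w.
  by move=> /ascP asc av; rewrite -[w]sK; apply: avoids321_distributive.
split=> [w lew|].
  split=> [|mod_w]; first exact: distributive_modular.
  exact/av_distributive/modular_av.
(* Left multiplication by [sigma k] is the bijection from 321-avoiding permutations with an ascent
   at [k] to the tops [w]. *)
rewrite -(card_avoids321_ascent k) -[RHS](card_imset _ (mulgI (sigma k))).
congr #|pred_of_set _|; apply/setP => w; rewrite inE.
apply/asboolP/imsetP => [[lew dist]|[v + ->]].
  exists (sigma k * w)%g; last by rewrite sK.
  rewrite inE (modular_av _ lew (distributive_modular dist)) descent_at_lo_hi.
  by rewrite -leqNgt ltnW //; apply/ascP.
rewrite inE descent_at_lo_hi -leqNgt leq_eqVlt => /andP[av /orP[/eqP|asc]].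
  by move/val_inj/perm_inj/(congr1 val) => /=; lia.
have lew : weak_le (sigma k) (sigma k * v)%g by apply/ascP; rewrite sK.
by split=> //; apply: av_distributive; rewrite ?sK.
Qed.
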